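(* Let $\{z_n\}_{n=1}^\infty$ be a separated sequence of points in $\mathbb{D}$. Suppose that there exists a sequence $\Lambda \subset \mathbb{D}$ satisfying the following properties: (i) for each pair of distinct points $z_j, z_k \in \{z_n\}_{n=1}^\infty$ there corresponds a point $\xi_{j,k} \in \Lambda$ such that $\xi_{j,k} \in \langle z_j, z_k \rangle$; (ii) each separated subsequence of $\Lambda$ is uniformly separated. Then $\{z_n\}_{n=1}^\infty$ is uniformly separated.
   Context: $\mathbb{D}$ is the open unit disc of the complex plane $\mathbb{C}$. For $z,w\in\mathbb{D}$, $\varrho(z,w)=|z-w|/|1-\overline{z}w|$ is the pseudo-hyperbolic distance. A sequence $\{z_n\}$ in $\mathbb{D}$ is called separated if there exists a constant $0<\delta<1$ such that $\varrho(z_n,z_k)>\delta$ for all indices $n\neq k$. It is called uniformly separated if $\inf_{k} \prod_{n\neq k} \varrho(z_n,z_k)>0$, where $n,k$ range over the index set of the sequence. For two distinct points $z,w\in\mathbb{D}$, $\langle z,w\rangle\subset\mathbb{D}$ denotes the hyperbolic segment joining $z$ and $w$, i.e. the closed subarc with endpoints $z$ and $w$ of the unique hyperbolic geodesic of $\mathbb{D}$ through $z$ and $w$ (geodesics being the intersections with $\mathbb{D}$ of circles orthogonal to $\partial\mathbb{D}$ and of straight lines through the origin). *)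

(* Defs.v *)
From HB Require Import structures.
From mathcomp Require Import all_boot all_order all_algebra.
From mathcomp Require Import all_classical all_reals all_analysis.
From mathcomp Require Export complex.

Set Implicit Arguments.
Unset Strict Implicit.
Unset Printing Implicit Defensive.

Import Order.TTheory GRing.Theory Num.Theory.
Import numFieldNormedType.Exports.
Import complex.ComplexField.Normc.

Local Open Scope classical_set_scope.
Local Open Scope ring_scope.
Local Open Scope complex_scope.

Definition unit_disc (R : realType) : set R[i] := [set z | normc z < 1].

Definition pseudohyp (R : realType) (z w : R[i]) : R :=
  normc (z - w) / normc (1 - z^* * w).

(* A sequence is given by its (finite or infinite) index set [I : set nat] and
   a function whose values outside [I] are irrelevant; its subsequences are the
   restrictions to the subsets of [I]. *)
Definition separated_seq (R : realType) (I : set nat) (z : nat -> R[i]) : Prop :=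
  exists2 delta : R, 0 < delta < 1 &
    forall n k, I n -> I k -> n <> k -> delta < pseudohyp (z n) (z k).

(* For points of the disc the factors lie in [0, 1], so the partial products
   converge. The infimum is taken in the extended reals, so that over an empty
   index set it is +oo and not the default value 0 of [inf]. *)
Definition uniformly_separated_seq (R : realType) (I : set nat)
    (z : nat -> R[i]) : Prop :=
  (0 < ereal_inf
    [set (lim ((fun N : nat =>
             \prod_(n < N | ((n : nat) \in I) && ((n : nat) != k))
               pseudohyp (z n) (z k))
           @ \oo))%:E | k in I])%E.

(* Two circles are orthogonal if they meet and, at each common point [p], the
   radii [p - 0] and [p - c] are perpendicular. *)
Definition orthogonal_to_unit_circle (R : realType) (c : R[i]) (r : R) : Prop :=
  (exists p, normc p = 1 /\ normc (p - c) = r) /\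
  (forall p, normc p = 1 -> normc (p - c) = r -> complex.Re (p^* * (p - c)) = 0).

Definition geodesic (R : realType) (G : set R[i]) : Prop :=
  (exists (c : R[i]) (r : R), [/\ 0 < r, orthogonal_to_unit_circle c r &
     G = @unit_disc R `&` [set x | normc (x - c) = r]]) \/
  (exists u : R[i], u <> 0 /\
     G = @unit_disc R `&` [set x | exists t : R, x = t%:C * u]).

(* [R[i]^o] carries the topology of the norm of [R[i]]. *)
Definition arc_between (R : realType) (z w : R[i]) (A : set R[i]) : Prop :=
  exists gamma : R -> R[i]^o,
    [/\ {within `[0, 1], continuous gamma},
        {in `[0, 1] &, injective gamma},
        gamma 0 = z, gamma 1 = w & A = gamma @` `[0, 1]].

Definition hyp_segment (R : realType) (z w : R[i]) : set R[i] :=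
  [set x | exists G A, [/\ geodesic G, arc_between z w A, A `<=` G & A x]].

(* Main.v *)
Require Import Defs.
From mathcomp Require Import all_boot all_order all_algebra.
From mathcomp Require Import all_classical all_reals all_analysis.
From mathcomp Require Import ring lra.

Set Implicit Arguments.
Unset Strict Implicit.
Unset Printing Implicit Defensive.

Import Order.TTheory GRing.Theory Num.Theory.
Import numFieldNormedType.Exports.
Import complex.ComplexField.Normc.

Local Open Scope classical_set_scope.
Local Open Scope ring_scope.

(** Write [h a = 1 - |a|^2] ([defect]), [P a b = |1 - conj a * b|] ([szego])
and [K a b = h a * h b / P a b ^ 2 = 1 - rho(a, b)^2] ([kernel]); [K] is
comparable to the exponential of minus the hyperbolic distance.  In terms of
[K], a separated sequence is uniformly separated as soon as the sums
[\sum_n K (z n) (z k)] are bounded in [k] (the products and the sums control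
each other), so it suffices to bound these sums.

The plane hyperbolic geometry that is needed is that of a tree.  It follows from
Ptolemy's inequality [szego_ptolemy] for [P], which is one algebraic identity,
and from the fact that a point [xi] of the segment [<z, w>] satisfies
[P z xi * P xi w <= P z w * h xi] ([szego_hyp_segment]; with the half distances
[s] and [t] it reads [cosh s * cosh t <= cosh (s + t)]).

Choose a maximal separated subfamily [Lambda'] of [Lambda] ([greedy_net]).  Every
point of [Lambda] is close to [Lambda'], so up to a constant all pairs
[z j, z k] have a point of [Lambda'] between them.  The family [Lambda'] is
uniformly separated, hence [\sum_m K (l m) (l k)] is bounded for base points
[l k] in [Lambda'].  The bound passes to sums based at an arbitrary point of the
disc ([sum_kernel_le]): moving the base point to [0], this is the inequality
[(\sum h)^2 <= 2 * M * \sum h], a consequence of the positivity of the harmonic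
reproducing kernel [(1 - |v w|^2) / P v w ^ 2].

It remains to compare the sums over [z] with the sums over [Lambda']
([sum_defect_skeleton]).  View the disc as a tree with root at the base point, a
point at depth [d] having weight about [exp (- d)].  Assign to each [z i] the
deepest point [l] of [Lambda'] on the path from the root to [z i].  If [z i] and
[z j] get the same [l], the point of [Lambda'] between them lies on one of the two
paths, so it is not deeper than [l], which forces the two paths to separate near
[l].  By separation of [z] and a packing argument in the Euclidean disc of
radius comparable to [h l], boundedly many [z i] get the same [l], each of weight
at most a constant times that of [l].  At most one [z i] gets no [l]. *)

(** * Kernels of the unit disc and Moebius maps *)

Section ComplexModulus.
Variable R : realType.
Implicit Types a b c x y z w : R[i].

Lemma sqr_normc z : normc z ^+ 2 = complex.Re z ^+ 2 + complex.Im z ^+ 2.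
Proof. by case: z => a b /=; rewrite sqr_sqrtr // addr_ge0 ?sqr_ge0. Qed.

Lemma normc_ge0 z : 0 <= normc z.
Proof. by case: z => a b /=; rewrite sqrtr_ge0. Qed.

Lemma normc_gt0 z : z <> 0 -> 0 < normc z.
Proof.
by move=> z0; rewrite lt_def normc_ge0 andbT; apply/eqP => /eq0_normc.
Qed.

Lemma normcz0 : normc (0 : R[i]) = 0.
Proof. exact: normc0. Qed.

Lemma normc_conj z : normc z^* = normc z.
Proof. by case: z => a b; rewrite [LHS]/= sqrrN. Qed.

Lemma normcB z w : normc (z - w) = normc (w - z).
Proof. by rewrite -normcN opprB. Qed.

Lemma ler_abs_Re_normc z : `|complex.Re z| <= normc z.
Proof.
rewrite -(ler_pXn2r (n := 2)) ?nnegrE ?normc_ge0 //.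
by rewrite sqr_normc real_normK ?num_real // lerDl sqr_ge0.
Qed.

Lemma ler_abs_Im_normc z : `|complex.Im z| <= normc z.
Proof.
rewrite -(ler_pXn2r (n := 2)) ?nnegrE ?normc_ge0 //.
by rewrite sqr_normc real_normK ?num_real // lerDr sqr_ge0.
Qed.

Lemma ler_Re_normc z : complex.Re z <= normc z.
Proof. exact: le_trans (ler_norm _) (ler_abs_Re_normc z). Qed.

Lemma normcX z n : normc (z ^+ n) = normc z ^+ n.
Proof.
elim: n => [|n IHn]; first by rewrite !expr0 normc1.
by rewrite !exprS normcM IHn.
Qed.

End ComplexModulus.

Section DiscKernel.
Variable R : realType.
Implicit Types a b c x y z w : R[i].

Definition defect z : R := 1 - normc z ^+ 2.

(** The inverse of the modulus of the Szego kernel. *)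
Definition szego z w : R := normc (1 - z^* * w).

(** The inverse of the squared hyperbolic cosine of half the hyperbolic distance. *)
Definition kernel z w : R := defect z * defect w / szego z w ^+ 2.

Lemma defect_gt0 z : unit_disc z -> 0 < defect z.
Proof. by move=> zD; rewrite subr_gt0 expr_lt1 ?normc_ge0. Qed.

Lemma defect_le1 z : defect z <= 1.
Proof. by rewrite lerBlDr lerDl sqr_ge0. Qed.

Lemma szegoC z w : szego z w = szego w z.
Proof.
by rewrite /szego -[LHS]normc_conj rmorphB rmorph1 rmorphM /= conjCK mulrC.
Qed.

Lemma szego_ge0 z w : 0 <= szego z w.
Proof. exact: normc_ge0. Qed.

Lemma szego0 z : szego z 0 = 1.
Proof. by rewrite /szego mulr0 subr0 normc1. Qed.

Lemma sqr_szego z w :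
  szego z w ^+ 2 = normc (z - w) ^+ 2 + defect z * defect w.
Proof.
rewrite /szego /defect !sqr_normc; case: z w => [a b] [c d] /=; ring.
Qed.

Lemma szego_gt0 z w : unit_disc z -> unit_disc w -> 0 < szego z w.
Proof.
move=> zD wD; rewrite -(ltr_pXn2r (n := 2)) ?nnegrE ?szego_ge0 // expr0n /=.
by rewrite sqr_szego ltr_wpDl ?sqr_ge0 // mulr_gt0 // defect_gt0.
Qed.

Lemma ler_dist_szego z w : unit_disc z -> unit_disc w ->
  normc (z - w) <= szego z w.
Proof.
move=> zD wD; rewrite -(ler_pXn2r (n := 2)) ?nnegrE ?szego_ge0 ?normc_ge0 //.
by rewrite sqr_szego lerDl mulr_ge0 // ltW // defect_gt0.
Qed.

Lemma szegoxx z : unit_disc z -> szego z z = defect z.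
Proof.
move=> zD; apply/eqP; rewrite -(eqrXn2 (n := 2)) ?szego_ge0 ?ltW ?defect_gt0 //.
by rewrite sqr_szego subrr normcz0 expr0n add0r.
Qed.

Lemma kernel_gt0 z w : unit_disc z -> unit_disc w -> 0 < kernel z w.
Proof.
move=> zD wD.
by rewrite divr_gt0 ?exprn_gt0 ?szego_gt0 // mulr_gt0 // defect_gt0.
Qed.

Lemma kernelC z w : kernel z w = kernel w z.
Proof. by rewrite /kernel szegoC [defect z * _]mulrC. Qed.

Lemma kernelxx z : unit_disc z -> kernel z z = 1.
Proof.
by move=> zD; rewrite /kernel szegoxx // -expr2 divff // expf_neq0 // gt_eqF // defect_gt0.
Qed.

Lemma sqr_pseudohyp z w : unit_disc z -> unit_disc w ->
  pseudohyp z w ^+ 2 = 1 - kernel z w.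
Proof.
move=> zD wD; have P0 : szego z w != 0 by rewrite gt_eqF // szego_gt0.
rewrite /pseudohyp -/(szego z w) expr_div_n /kernel.
have -> : normc (z - w) ^+ 2 = szego z w ^+ 2 - defect z * defect w.
  by rewrite sqr_szego addrK.
by rewrite mulrBl divff // expf_neq0.
Qed.

Lemma pseudohyp_ge0 z w : 0 <= pseudohyp z w.
Proof. by rewrite divr_ge0 ?normc_ge0. Qed.

Lemma pseudohyp_lt1 z w : unit_disc z -> unit_disc w -> pseudohyp z w < 1.
Proof.
move=> zD wD; rewrite -(expr_lt1 (n := 2)) ?pseudohyp_ge0 // sqr_pseudohyp //.
by rewrite ltrBlDr ltrDl kernel_gt0.
Qed.

Lemma pseudohypC z w : pseudohyp z w = pseudohyp w z.
Proof. by rewrite /pseudohyp normcB -!/(szego _ _) szegoC. Qed.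

(** Two of the three products [(1 - conj _ * _) * (1 - conj _ * _)] formed from four
points differ by a product of two Euclidean differences, and
[|z - w| <= szego z w]. *)
Lemma szego_ptolemy a b c x :
  unit_disc a -> unit_disc b -> unit_disc c -> unit_disc x ->
  szego a c * szego b x <= szego a x * szego b c + szego a b * szego c x.
Proof.
move=> aD bD cD xD; rewrite /szego -!normcM.
have -> : (1 - a^* * c) * (1 - b^* * x) =
  (1 - a^* * x) * (1 - b^* * c) + (a - b)^* * (x - c).
  by rewrite rmorphB /=; ring.
apply: le_trans (le_normcD _ _) _; rewrite lerD2l !normcM normc_conj.
by rewrite ler_pM ?normc_ge0 ?ler_dist_szego // normcB ler_dist_szego.
Qed.

Lemma unit_disc0 : unit_disc (0 : R[i]).
Proof. by rewrite /unit_disc /mkset normcz0. Qed.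

(** Ptolemy's inequality with the fourth point at the origin, where
[szego _ 0 = 1]. *)
Lemma szego_triangle a b c : unit_disc a -> unit_disc b -> unit_disc c ->
  szego a c <= szego a b + szego b c.
Proof.
move=> aD bD cD; have := szego_ptolemy aD bD cD unit_disc0.
by rewrite !szego0 !mulr1 mul1r addrC.
Qed.

Lemma defect_le_szego a b : unit_disc a -> unit_disc b ->
  defect a <= 2 * szego a b.
Proof.
move=> aD bD; rewrite -szegoxx // mulr2n mulrDl !mul1r.
by rewrite {2}(szegoC a b) szego_triangle.
Qed.

(** Moving an endpoint by a bounded distance changes a kernel by a bounded
factor: this is how points of a family are replaced by points of a net. *)
Lemma szego_neighbour x a b :
  unit_disc x -> unit_disc a -> unit_disc b ->
  szego x b * defect a <= 2 * szego x a * szego a b.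
Proof.
move=> xD aD bD; have := szego_ptolemy xD aD bD aD.
by rewrite szegoxx // (szegoC b a) => h; lra.
Qed.

Definition moebius a z : R[i] := (z - a) / (1 - a^* * z).

Lemma one_sub_neq0 z w : unit_disc z -> unit_disc w -> 1 - z^* * w != 0.
Proof.
move=> zD wD; apply/eqP => e; have := szego_gt0 zD wD.
by rewrite /szego e normcz0 ltxx.
Qed.

Lemma szego_moebius a z w : unit_disc a -> unit_disc z -> unit_disc w ->
  szego (moebius a z) (moebius a w) =
  szego z w * defect a / (szego a z * szego a w).
Proof.
move=> aD zD wD; rewrite [szego a z]szegoC -[defect a]szegoxx // /szego.
rewrite -!normcM -normcV -normcM.
have n1 := one_sub_neq0 zD aD; have n2 := one_sub_neq0 aD wD.
have n3 := one_sub_neq0 aD zD.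
congr normc; rewrite /moebius fmorph_div !rmorphB rmorphM rmorph1 /= conjCK.
by field; rewrite n1 n2.
Qed.

Lemma dist_moebius a z w : unit_disc a -> unit_disc z -> unit_disc w ->
  normc (moebius a z - moebius a w) =
  normc (z - w) * defect a / (szego a z * szego a w).
Proof.
move=> aD zD wD; rewrite -[defect a]szegoxx // /szego.
rewrite -!normcM -normcV -normcM.
have n2 := one_sub_neq0 aD wD.
have n3 := one_sub_neq0 aD zD.
by congr normc; rewrite /moebius; field; rewrite n2 n3.
Qed.

Lemma pseudohyp_moebius a z w : unit_disc a -> unit_disc z -> unit_disc w ->
  pseudohyp (moebius a z) (moebius a w) = pseudohyp z w.
Proof.
move=> aD zD wD; rewrite /pseudohyp -!/(szego _ _) szego_moebius // dist_moebius //.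
have := szego_gt0 aD zD; have := szego_gt0 aD wD; have := szego_gt0 zD wD.
move=> /lt0r_neq0 n1 /lt0r_neq0 n2 /lt0r_neq0 n3.
have /lt0r_neq0 n4 := defect_gt0 aD.
by field; rewrite n1 n2 n3 n4.
Qed.

Lemma unit_discP z : unit_disc z <-> 0 < defect z.
Proof.
split; first exact: defect_gt0.
by rewrite subr_gt0 expr_lt1 ?normc_ge0.
Qed.

Lemma moebius_kernel a z : unit_disc a -> unit_disc z ->
  defect (moebius a z) = kernel a z.
Proof.
move=> aD zD; have n1 := lt0r_neq0 (szego_gt0 aD zD).
rewrite /defect /kernel /moebius normcM normcV -/(szego a z) expr_div_n.
have -> : normc (z - a) ^+ 2 = szego a z ^+ 2 - defect a * defect z.
  by rewrite sqr_szego normcB addrK.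
by field.
Qed.

Lemma moebius_disc a z : unit_disc a -> unit_disc z -> unit_disc (moebius a z).
Proof.
by move=> aD zD; apply/unit_discP; rewrite moebius_kernel // kernel_gt0.
Qed.

Lemma kernel_moebius a z w : unit_disc a -> unit_disc z -> unit_disc w ->
  kernel (moebius a z) (moebius a w) = kernel z w.
Proof.
move=> aD zD wD; have/= := sqr_pseudohyp (moebius_disc aD zD) (moebius_disc aD wD).
rewrite pseudohyp_moebius // sqr_pseudohyp // => h; lra.
Qed.

End DiscKernel.

(** * Points of hyperbolic segments *)

Section HyperbolicSegment.
Variable R : realType.
Implicit Types c u x y z w xi : R[i].

Lemma sqr_normcD x y :
  normc (x + y) ^+ 2 =
  normc x ^+ 2 + normc y ^+ 2 + 2 * complex.Re (x^* * y).
Proof. rewrite !sqr_normc; case: x y => [a b] [c d] /=; ring. Qed.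

(** A positive multiple of [(z - xi) / (1 - conj xi * z)], so its argument is the
direction in which [z] is seen from [xi]. *)
Definition bearing xi z : R[i] := (z - xi) * (1 - xi * z^*).

(** If [z] and [w] are seen from [xi] in directions at a nonacute angle, the two
terms of [(1 - conj z * w) * (1 - |xi|^2) =
(1 - conj z * xi) * (1 - conj xi * w) + conj (z - xi) * (xi - w)]
have a nonnegative inner product, and the modulus of the sum is at least that of
the first term. *)
Lemma szego_between xi z w : unit_disc xi -> unit_disc z -> unit_disc w ->
  complex.Re ((bearing xi z)^* * bearing xi w) <= 0 ->
  szego z xi * szego xi w <= szego z w * defect xi.
Proof.
move=> xiD zD wD Re_le0; rewrite -[defect xi]szegoxx // /szego -!normcM.
rewrite -(ler_pXn2r (n := 2)) ?nnegrE ?normc_ge0 //.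
have -> : (1 - z^* * w) * (1 - xi^* * xi) =
  (1 - z^* * xi) * (1 - xi^* * w) + (z - xi)^* * (xi - w).
  by rewrite rmorphB /=; ring.
rewrite [leRHS]sqr_normcD.
have -> : ((1 - z^* * xi) * (1 - xi^* * w))^* * ((z - xi)^* * (xi - w)) =
  - ((bearing xi z)^* * bearing xi w).
  by rewrite /bearing !(rmorphM, rmorphB, rmorph1) /= !conjCK; ring.
rewrite [complex.Re (- _)](_ : _ = - complex.Re ((bearing xi z)^* * bearing xi w)).
  by have := sqr_ge0 (normc ((z - xi)^* * (xi - w))); lra.
by case: (_^* * _).
Qed.

Definition dot u x : R := complex.Re (u^* * x).

Lemma dotE u x : dot u x =
  complex.Re u * complex.Re x + complex.Im u * complex.Im x.
Proof. by case: u x => [a b] [c d]; rewrite /dot /= mulNr opprK. Qed.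

(** Seen from a point [xi] of a geodesic, all its points lie in one direction or
in the opposite one, and a linear coordinate that is injective on the geodesic
tells which.  On the circle of centre [c] the bearing of [z] is
[2i * (c - xi) * Im (conj xi * z)], which suggests the coordinate
[Im (conj xi * _)]; on a diameter the position along it works. *)
Lemma geodesic_parameter (G : set R[i]) xi : geodesic G -> G xi ->
  exists v : R[i], (forall x y, G x -> G y -> dot v x = dot v y -> x = y) /\
    forall z w, G z -> G w ->
      (dot v z - dot v xi) * (dot v w - dot v xi) <= 0 ->
      complex.Re ((bearing xi z)^* * bearing xi w) <= 0.
Proof.
case=> [[c [r [r0 [[p [p1 pr]] orth] ->]]]|[u [u0 ->]]].
- have c2 : normc c ^+ 2 = 1 + r ^+ 2.
    have := orth _ p1 pr; rewrite -pr.
    have : normc p ^+ 2 = 1 by rewrite p1 expr1n.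
    rewrite !sqr_normc; case: (p) (c) => [a b] [d e] /= h1 h2; nra.
  (* Since [|c|^2 = 1 + r^2] by orthogonality, the constant terms of the equation
     of the circle cancel to [1]. *)
  have onG x : (@unit_disc R `&` [set x | normc (x - c) = r]) x ->
      complex.Re x ^+ 2 + complex.Im x ^+ 2 < 1 /\
      complex.Re x ^+ 2 + complex.Im x ^+ 2 + 1 = 2 * dot c x.
    case=> xD xr; split; first by rewrite -sqr_normc expr_lt1 ?normc_ge0.
    move: c2; rewrite -xr dotE !sqr_normc; case: (x) (c) => [a b] [d e] /=; lra.
  move=> /onG [xiD xiE]; exists (Complex (- complex.Im xi) (complex.Re xi)).
  split=> [x y /onG [xD xE] /onG [yD yE]|z w /onG [zD zE] /onG [wD wE]].
  + move: xiD xiE xD xE yD yE; rewrite !dotE.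
    case: x y xi c {c2 onG p1 pr orth} => [x1 x2] [y1 y2] [k1 k2] [c1 c2] /=.
    move=> xiD xiE xD xE yD yE e.
    have k0 : 0 < k1 ^+ 2 + k2 ^+ 2.
      rewrite lt_def addr_ge0 ?sqr_ge0 // andbT; apply/negP.
      rewrite paddr_eq0 ?sqr_ge0 // !sqrf_eq0 => /andP[/eqP k1E /eqP k2E].
      by move: xiE; rewrite k1E k2E; lra.
    (* Two points with the same coordinate differ by a multiple of [xi]; comparing
       their equations forces this multiple to vanish. *)
    pose s := k1 * (x1 - y1) + k2 * (x2 - y2).
    have s1 : (k1 ^+ 2 + k2 ^+ 2) * (x1 - y1) = s * k1.
      have -> : (k1 ^+ 2 + k2 ^+ 2) * (x1 - y1) =
        s * k1 + k2 * (k2 * x1 - k1 * x2 - (k2 * y1 - k1 * y2)) by rewrite /s; ring.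
      by rewrite (_ : _ - _ - _ = 0) ?mulr0 ?addr0 //; lra.
    have s2 : (k1 ^+ 2 + k2 ^+ 2) * (x2 - y2) = s * k2.
      have -> : (k1 ^+ 2 + k2 ^+ 2) * (x2 - y2) =
        s * k2 - k1 * (k2 * x1 - k1 * x2 - (k2 * y1 - k1 * y2)) by rewrite /s; ring.
      by rewrite (_ : _ - _ - _ = 0) ?mulr0 ?subr0 //; lra.
    have sE : s * (k1 ^+ 2 + k2 ^+ 2 + 1 - (k1 * (x1 + y1) + k2 * (x2 + y2))) = 0.
      have -> : s * (k1 ^+ 2 + k2 ^+ 2 + 1 - (k1 * (x1 + y1) + k2 * (x2 + y2))) =
        s * (2 * (c1 * k1 + c2 * k2)) - (s * k1 * (x1 + y1) + s * k2 * (x2 + y2)).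
        by rewrite xiE; ring.
      have -> : s * (2 * (c1 * k1 + c2 * k2)) = 2 * (c1 * (s * k1) + c2 * (s * k2)) by ring.
      rewrite -s1 -s2.
      rewrite (_ : _ - _ = (k1 ^+ 2 + k2 ^+ 2) * (2 * (c1 * x1 + c2 * x2) - 2 * (c1 * y1 + c2 * y2) - (x1 ^+ 2 + x2 ^+ 2 - (y1 ^+ 2 + y2 ^+ 2)))); last by ring.
      by rewrite -xE -yE; ring.
    have n0 : 0 < k1 ^+ 2 + k2 ^+ 2 + 1 - (k1 * (x1 + y1) + k2 * (x2 + y2)).
      have := sqr_ge0 (k1 - x1); have := sqr_ge0 (k2 - x2).
      have := sqr_ge0 (k1 - y1); have := sqr_ge0 (k2 - y2).
      nra.
    have s0 : s = 0.
      by move/eqP: sE; rewrite mulf_eq0 (gt_eqF n0) orbF => /eqP.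
    move: s1 s2; rewrite s0 !mul0r => /eqP + /eqP.
    by rewrite !mulf_eq0 (gt_eqF k0) /= !subr_eq0 => /eqP -> /eqP ->.
  + rewrite !dotE /=.
    have bE v : complex.Re v ^+ 2 + complex.Im v ^+ 2 + 1 = 2 * dot c v ->
      complex.Re (bearing xi v) = - 2 * (complex.Im c - complex.Im xi) * (complex.Re xi * complex.Im v - complex.Im xi * complex.Re v) /\
      complex.Im (bearing xi v) = 2 * (complex.Re c - complex.Re xi) * (complex.Re xi * complex.Im v - complex.Im xi * complex.Re v).
      move: xiE; rewrite !dotE /bearing; case: v xi c {c2 onG p1 pr orth xiD zE wE} => [v1 v2] [k1 k2] [c1 c2].
      move=> /= xiE vE; split.
      - rewrite [LHS](_ : _ = - 2 * (c2 - k2) * (k1 * v2 - k2 * v1)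
          + v1 * (k1 ^+ 2 + k2 ^+ 2 + 1 - 2 * (c1 * k1 + c2 * k2))
          - k1 * (v1 ^+ 2 + v2 ^+ 2 + 1 - 2 * (c1 * v1 + c2 * v2))); last by ring.
        by rewrite xiE vE !subrr !mulr0 addr0 subr0.
      - rewrite [LHS](_ : _ = 2 * (c1 - k1) * (k1 * v2 - k2 * v1)
          + v2 * (k1 ^+ 2 + k2 ^+ 2 + 1 - 2 * (c1 * k1 + c2 * k2))
          - k2 * (v1 ^+ 2 + v2 ^+ 2 + 1 - 2 * (c1 * v1 + c2 * v2))); last by ring.
        by rewrite xiE vE !subrr !mulr0 addr0 subr0.
    rewrite -/(dot _ _) dotE; have [-> ->] := bE _ zE; have [-> ->] := bE _ wE.
    set g := _ - complex.Im xi * complex.Re z.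
    set g' := _ - complex.Im xi * complex.Re w => gg.
    have {}gg : g * g' <= 0 by move: gg; rewrite /g /g'; lra.
    set p1' := complex.Im c - _; set p2' := complex.Re c - _.
    rewrite [leLHS](_ : _ = 4 * (p1' ^+ 2 + p2' ^+ 2) * (g * g')); last by ring.
    by rewrite mulr_ge0_le0 // mulr_ge0 // addr_ge0 ?sqr_ge0.
- case=> xiD [t xiE]; exists u; rewrite xiE.
  have uu : 0 < complex.Re u ^+ 2 + complex.Im u ^+ 2.
    by rewrite -sqr_normc exprn_gt0 // normc_gt0.
  have dE s : dot u (s%:C%C * u) = s * (complex.Re u ^+ 2 + complex.Im u ^+ 2).
    by rewrite dotE; case: (u) => [u1 u2] /=; ring.
  split=> [x y [_ [s ->]] [_ [s' ->]]|z w [zD [s zE]] [wD [s' wE]]].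
    by rewrite !dE => /(mulIf (lt0r_neq0 uu)) ->.
  have pos v q : unit_disc v -> v = q%:C%C * u ->
      0 < 1 - q * t * (complex.Re u ^+ 2 + complex.Im u ^+ 2).
    move=> vD vE; rewrite subr_gt0.
    have -> : q * t * (complex.Re u ^+ 2 + complex.Im u ^+ 2) =
        complex.Re (xi^* * v).
      by rewrite xiE vE; case: (u) => [u1 u2] /=; ring.
    apply: le_lt_trans (ler_Re_normc _) _; rewrite normcM normc_conj.
    apply: mulr_ilt1; rewrite ?normc_ge0 //.
  have bE v q : v = q%:C%C * u ->
      complex.Re (bearing (t%:C%C * u) v) = (q - t) * (1 - q * t * (complex.Re u ^+ 2 + complex.Im u ^+ 2)) * complex.Re u /\
      complex.Im (bearing (t%:C%C * u) v) = (q - t) * (1 - q * t * (complex.Re u ^+ 2 + complex.Im u ^+ 2)) * complex.Im u.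
    move=> ->; rewrite /bearing; case: (u) => [u1 u2] /=; split; ring.
  have := pos _ _ zD zE; have := pos _ _ wD wE.
  rewrite -/(dot (bearing _ _) _) [dot (bearing _ _) _]dotE.
  have [-> ->] := bE _ _ zE; have [-> ->] := bE _ _ wE.
  rewrite zE wE !dE.
  set n := _ + complex.Im u ^+ 2; set a := 1 - _; set b := 1 - _ => b0 a0 st.
  have {}st : (s - t) * (s' - t) <= 0.
    rewrite -(pmulr_rle0 _ (mulr_gt0 uu uu)); rewrite /n.
    by rewrite [leLHS](_ : _ = (s * n - t * n) * (s' * n - t * n)) // /n; ring.
  rewrite [leLHS](_ : _ = a * b * n * ((s - t) * (s' - t))); last by rewrite /n; ring.
  by rewrite mulr_ge0_le0 // !mulr_ge0 // ltW.
Qed.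

Lemma dot_continuous u : continuous (dot u : R[i]^o -> R).
Proof.
move=> x B /nbhs_normP [e /= e0 eB].
rewrite /nbhs /=; apply: (nbhs_normP (x : R[i]^o) _).1.
have u0 : 0 < normc u + 1 by rewrite ltr_wpDl ?normc_ge0.
exists (e / (normc u + 1))%:C%C => /=.
  by rewrite ltcR divr_gt0.
move=> y; rewrite /ball_ /= -[`|x - y|]/((normc (x - y))%:C%C) ltcR ltr_pdivlMr // => xy.
apply: eB; rewrite /ball_ /=; apply: le_lt_trans xy.
have -> : dot u x - dot u y = dot u (x - y).
  by rewrite !dotE; case: (x) (y) => [a b] [c d] /=; ring.
rewrite mulrDr mulr1 ler_wpDr ?normc_ge0 // ler_norml mulrC.
have h v : dot u v <= normc u * normc v.
  by rewrite -[normc u]normc_conj -normcM; exact: ler_Re_normc.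
rewrite h andbT lerNl.
have -> : - dot u (x - y) = dot u (y - x).
  by rewrite !dotE; case: (x) (y) => [a b] [c d] /=; ring.
by rewrite normcB h.
Qed.

(** Along the arc the coordinate of [geodesic_parameter] is continuous and
injective, hence monotone, so [z] and [w] lie on different sides of [xi]. *)
Lemma szego_hyp_segment z w xi : hyp_segment z w xi ->
  szego z xi * szego xi w <= szego z w * defect xi.
Proof.
case=> G [A [gG [gamma [gC gI g0 g1 ->]] AG [t t01 gt]]].
have inG s : s \in `[0, 1] -> G (gamma s) by move=> s01; apply: AG; exists s.
have Gxi : G xi by rewrite -gt; apply: inG.
have GD x : G x -> unit_disc x.
  by case: gG => [[c [r [_ _ ->]]]|[u [_ ->]]] [].
have Gz : G z by rewrite -g0; apply: inG; rewrite in_itv /= lexx ler01.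
have Gw : G w by rewrite -g1; apply: inG; rewrite in_itv /= lexx ler01.
have [v [vI vP]] := geodesic_parameter gG Gxi.
apply: szego_between; try exact: GD.
apply: vP => //.
pose f s : R := dot v (gamma s).
have fI : {in `[0, 1] &, injective f}.
  by move=> s s' s01 s'01 /(vI _ _ (inG _ s01) (inG _ s'01)); apply: gI.
have fC : {within `[0, 1], continuous f}.
  move=> s.
  exact: (@continuous_comp (subspace [set` `[(0 : R), 1]]) R[i]^o R gamma (dot v) s (gC s) (@dot_continuous v _)).
have t0 : 0 <= t by move: t01; rewrite /= in_itv /= => /andP[].
have t1 : t <= 1 by move: t01; rewrite /= in_itv /= => /andP[].
have I0 : (0 : R) \in `[0, 1] by rewrite in_itv /= lexx ler01.
have I1 : (1 : R) \in `[0, 1] by rewrite in_itv /= lexx ler01.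
rewrite -g0 -g1 -gt -!/(f _).
have [f01|/ltW f10] := leP (f 0) (f 1).
- have fm := segment_continuous_inj_le f01 fC fI.
  have h0 : f 0 <= f t by rewrite fm.
  have h1 : f t <= f 1 by rewrite fm.
  nra.
- have fm := segment_continuous_inj_ge f10 fC fI.
  have h0 : f t <= f 0 by rewrite fm.
  have h1 : f 1 <= f t by rewrite fm.
  nra.
Qed.

End HyperbolicSegment.

(** * Base points of kernel sums *)

Section CarlesonEnergy.
Variables (R : realType) (T : finType).
Implicit Types (v : T -> R[i]) (c : T -> R).

Lemma Re_sum (I : Type) (r : seq I) (F : I -> R[i]) :
  complex.Re (\sum_(i <- r) F i) = \sum_(i <- r) complex.Re (F i).
Proof. by elim/big_rec2: _ => // i x [a b] _ <- /=; case: (F i). Qed.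

(** Each power of [conj v * w] is a positive semidefinite kernel: its quadratic
form is a squared modulus. *)
Lemma normc_moment v c n :
  \sum_i \sum_j c i * c j * complex.Re (((v i)^* * v j) ^+ n) =
  normc (\sum_i (c i)%:C%C * v i ^+ n) ^+ 2.
Proof.
have -> (z : R[i]) : normc z ^+ 2 = complex.Re (z^* * z).
  by rewrite sqr_normc; case: z => [a b] /=; ring.
rewrite rmorph_sum mulr_suml Re_sum; apply: eq_bigr => i _.
rewrite mulr_sumr Re_sum; apply: eq_bigr => j _.
rewrite exprMn rmorphM rmorphXn /=.
case: (_ ^+ n) (_ ^+ n) => [a1 b1] [a2 b2] /=; ring.
Qed.

(** The quadratic form of [\sum_(m > n) x ^ m] with [x = conj v * w], in closed
form, so that positivity of the whole series needs no infinite sum. *)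
Definition tail_form v c n : R :=
  \sum_i \sum_j c i * c j *
    complex.Re (((v i)^* * v j) ^+ n.+1 / (1 - (v i)^* * v j)).

Lemma tail_form_decr v c n : (forall i, unit_disc (v i)) ->
  tail_form v c n.+1 <= tail_form v c n.
Proof.
move=> vD; suff -> : tail_form v c n =
    tail_form v c n.+1 + normc (\sum_i (c i)%:C%C * v i ^+ n.+1) ^+ 2.
  by rewrite lerDl sqr_ge0.
rewrite -normc_moment -big_split; apply: eq_bigr => i _.
rewrite -big_split; apply: eq_bigr => j _ /=.
have ReD (z w : R[i]) : complex.Re (z + w) = complex.Re z + complex.Re w.
  by case: z w => [a b] [d e].
rewrite -mulrDr -ReD; congr (_ * complex.Re _).
rewrite [in RHS]exprS; set x := _ * v j.
have x1 : 1 - x != 0 by apply: one_sub_neq0.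
by set y := x ^+ n.+1; field.
Qed.

(** The forms decrease in [n] and tend to [0]: on a finite family
[|conj v * w|] is at most some [q < 1]. *)
Lemma tail_form_ge0 v c : (forall i, unit_disc (v i)) -> 0 <= tail_form v c 0.
Proof.
move=> vD; pose q := \big[Num.max/0]_i normc (v i).
have q0 : 0 <= q by apply: bigmax_ge_id.
have q1 : q < 1 by apply: bigmax_lt => // i _; exact: vD.
have vq i : normc (v i) <= q by apply: le_bigmax.
pose C := \sum_i \sum_j `|c i * c j| / szego (v i) (v j).
have tailE n : - (C * q ^+ n) <= tail_form v c n.
  rewrite lerNl /tail_form -sumrN mulr_suml; apply: ler_sum => i _.
  rewrite -sumrN mulr_suml; apply: ler_sum => j _.
  apply: le_trans (ler_norm _) _; rewrite normrN normrM -mulrA ler_wpM2l //.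
  apply: le_trans (ler_abs_Re_normc _) _.
  rewrite normcM normcV -/(szego _ _) mulrC.
  rewrite ler_wpM2l ?invr_ge0 ?szego_ge0 // normcX normcM normc_conj.
  have xq : normc (v i) * normc (v j) <= q.
    by rewrite -[q]mulr1 ler_pM ?normc_ge0 //; exact/ltW/vD.
  rewrite exprSr -[leRHS]mulr1 ler_pM ?exprn_ge0 ?mulr_ge0 ?normc_ge0 //.
    by rewrite lerXn2r ?nnegrE ?mulr_ge0 ?normc_ge0.
  exact: le_trans xq (ltW q1).
have tail0 n : tail_form v c n <= tail_form v c 0.
  by elim: n => // n; apply: le_trans; exact: tail_form_decr.
have cv : (fun n => - (C * q ^+ n)) @ \oo --> (0 : R).
  rewrite -oppr0 -(mulr0 C); apply: cvgN; apply: cvgMr; apply: cvg_expr.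
  by rewrite ger0_norm.
rewrite -(cvg_lim _ cv) //; apply: limr_le; first by apply: cvgP cv.
by near=> n; apply: le_trans (tailE n) (tail0 n).
Unshelve. all: by end_near.
Qed.

(** The kernel on the right is [1 + 2 * Re (x / (1 - x))] with [x = conj v * w]: a
constant, which contributes the square of the sum, plus a positive form. *)
Lemma sqr_sum_le v c : (forall i, unit_disc (v i)) ->
  (\sum_i c i) ^+ 2 <= \sum_i \sum_j c i * c j *
    ((1 - normc (v i) ^+ 2 * normc (v j) ^+ 2) / szego (v i) (v j) ^+ 2).
Proof.
move=> vD; have := tail_form_ge0 c vD.
suff -> : \sum_i \sum_j c i * c j *
    ((1 - normc (v i) ^+ 2 * normc (v j) ^+ 2) / szego (v i) (v j) ^+ 2)
    = (\sum_i c i) ^+ 2 + 2 * tail_form v c 0 by lra.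
rewrite expr2 mulr_suml [2 * _]mulr_sumr -big_split; apply: eq_bigr => i _.
rewrite /= !mulr_sumr -big_split; apply: eq_bigr => j _ /=.
rewrite [2 * _]mulrCA -[X in _ = X + _]mulr1 -mulrDr; congr (_ * _).
rewrite expr1 -exprMn -[normc (v i)]normc_conj -normcM /szego.
have x1 : 1 - (v i)^* * v j != 0 by apply: one_sub_neq0.
set x := _ * v j in x1 *.
have n1 : normc (1 - x) ^+ 2 != 0.
  by rewrite expf_neq0 //; apply: contra_neq x1; apply: eq0_normc.
move: n1; rewrite !sqr_normc {x1}; case: x => [a b] /= n1.
by field; rewrite -[- b]add0r.
Qed.

(** Apply [sqr_sum_le] to the weights [c = defect]: as
[1 - |v w|^2 <= defect v + defect w], the right-hand side is at most
[2 * M * \sum_i defect (v i)]. *)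
Lemma sum_defect_le v M : (forall i, unit_disc (v i)) ->
  (forall i, \sum_j kernel (v i) (v j) <= M) -> 0 <= M ->
  \sum_i defect (v i) <= 2 * M.
Proof.
move=> vD vM M0; pose h i := defect (v i).
have h0 i : 0 < h i by exact: defect_gt0.
set S := \sum_i _.
have S0 : 0 <= S by apply: sumr_ge0 => i _; exact/ltW/h0.
suff : S ^+ 2 <= 2 * M * S.
  move: S0; rewrite le_eqVlt => /orP[/eqP<- _|S0]; first by rewrite mulr_ge0.
  by rewrite expr2 ler_pM2r.
apply: (le_trans (sqr_sum_le h vD)).
apply: (@le_trans _ _ (\sum_i \sum_j (h i + h j) * kernel (v i) (v j))).
  apply: ler_sum => i _; apply: ler_sum => j _.
  rewrite mulrCA -/(kernel (v i) (v j)) ler_wpM2r //; first exact/ltW/kernel_gt0.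
  have -> : normc (v i) ^+ 2 = 1 - h i by rewrite /h /defect; ring.
  have -> : normc (v j) ^+ 2 = 1 - h j by rewrite /h /defect; ring.
  by have := mulr_gt0 (h0 i) (h0 j); lra.
have hE : \sum_i \sum_j h i * kernel (v i) (v j) <= M * S.
  rewrite /S mulr_sumr; apply: ler_sum => i _.
  by rewrite -mulr_sumr mulrC ler_wpM2r // ltW.
rewrite (eq_bigr (fun i => \sum_j h i * kernel (v i) (v j) +
    \sum_j h j * kernel (v j) (v i))); last first.
  by move=> i _; rewrite -big_split; apply: eq_bigr => j _; rewrite mulrDl (kernelC (v j)).
rewrite big_split /= [X in _ + X <= _]exchange_big /=; move: hE; lra.
Qed.

(** A bound for the kernel sums based at the points of the family bounds those
based anywhere in the disc: a Moebius map takes [a] to the origin. *)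
Lemma sum_kernel_le v M a : unit_disc a -> (forall i, unit_disc (v i)) ->
  (forall i, \sum_j kernel (v i) (v j) <= M) -> 0 <= M ->
  \sum_i kernel a (v i) <= 2 * M.
Proof.
move=> aD vD vM M0.
rewrite (eq_bigr (fun i => defect (moebius a (v i)))) => [|i _]; last first.
  by rewrite moebius_kernel.
apply: sum_defect_le => // [i|i]; first exact: moebius_disc.
by apply: le_trans (vM i); apply/ler_sum => j _; rewrite kernel_moebius.
Qed.

End CarlesonEnergy.

(** * Counting points in the tree of the disc *)

Section Skeleton.
Variable R : realType.

Lemma truncn_eq_dist (a b : R) : 0 <= a -> 0 <= b ->
  Num.truncn a = Num.truncn b -> (a - b) ^+ 2 < 1.
Proof.
move=> /truncn_itv/andP[a1 a2] /truncn_itv/andP[b1 b2] ab.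
move: a1 a2; rewrite ab => a1 a2; move: a2 b2.
by rewrite -natr1 => a2 b2; nra.
Qed.

(** Cut the square of side [2 * r] around [p] into cells of side [d / 2]; each cell
contains at most one of the points. *)
Lemma card_separated_le (T : finType) (A : {set T}) (v : T -> R[i])
    (p : R[i]) (r d B : R) :
  0 < d -> (forall i, i \in A -> normc (v i - p) <= r) ->
  {in A &, forall i j, i != j -> d <= normc (v i - v j)} ->
  4 * r / d <= B ->
  (#|A| <= (Num.truncn B).+1 ^ 2)%N.
Proof.
move=> d0 vr vd rB; pose K := Num.truncn B.
pose cell (t : R) : 'I_K.+1 := inord (Num.truncn ((t + r) * (2 / d))).
have d20 : 0 < 2 / d by rewrite divr_gt0.
have rng t : `|t| <= r -> 0 <= (t + r) * (2 / d) /\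
    (Num.truncn ((t + r) * (2 / d)) < K.+1)%N.
  rewrite ler_norml => /andP[t1 t2]; have t0 : 0 <= t + r by lra.
  split; first by rewrite mulr_ge0 // ltW.
  rewrite ltnS le_truncn // (le_trans _ rB) //.
  have -> : 4 * r / d = (r + r) * (2 / d) by field; rewrite gt_eqF.
  by rewrite ler_pM2r // lerD2r.
have cellP t t' : `|t| <= r -> `|t'| <= r -> cell t = cell t' ->
    (t - t') ^+ 2 < d ^+ 2 / 4.
  move=> /rng[t0 tK] /rng[t'0 t'K] /(congr1 val); rewrite /= !inordK // => e.
  have := truncn_eq_dist t0 t'0 e.
  have -> : (t + r) * (2 / d) - (t' + r) * (2 / d) = (t - t') * (2 / d) by ring.
  rewrite exprMn -ltr_pdivlMr ?exprn_gt0 // div1r.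
  by have -> : ((2 / d) ^+ 2)^-1 = d ^+ 2 / 4 by field; rewrite gt_eqF.
pose f i := (cell (complex.Re (v i - p)), cell (complex.Im (v i - p))).
have -> : ((Num.truncn B).+1 ^ 2 = #|{: 'I_K.+1 * 'I_K.+1}|)%N.
  by rewrite card_prod card_ord.
apply: (@leq_card_in _ _ f) => i j iA jA [fR fI].
apply/eqP/negPn/negP => ij.
have := vd _ _ iA jA ij; apply/negP; rewrite -ltNge.
have -> : v i - v j = (v i - p) - (v j - p) by ring.
move: fR fI; move: (vr _ iA) (vr _ jA).
move: (v i - p) (v j - p) => x y xr yr fR fI.
have h1 := cellP _ _ (le_trans (ler_abs_Re_normc x) xr) (le_trans (ler_abs_Re_normc y) yr) fR.
have h2 := cellP _ _ (le_trans (ler_abs_Im_normc x) xr) (le_trans (ler_abs_Im_normc y) yr) fI.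
rewrite -(ltr_pXn2r (n := 2)) ?nnegrE ?normc_ge0 ?ltW //.
have d2 : 0 < d ^+ 2 by rewrite exprn_gt0.
move: h1 h2; rewrite sqr_normc; case: (x) (y) => [x1 x2] [y1 y2] /=; lra.
Qed.

(** The hyperbolic distances satisfy [d(z, xi) + d(xi, w) <= d(z, w) + c] for a
constant [c] that depends on [C].  Unlike membership in a segment, this is stable
under small perturbations of [xi] and obviously invariant under Moebius maps. *)
Definition fuzzy_between (C : R) (z xi w : R[i]) : Prop :=
  szego z xi * szego xi w <= C * szego z w * defect xi.

(** A packing of points at mutual distance [d = delta * h / (4 * C)] in a disc of
radius [r = 2 * C * h] has [4 * r / d = 32 * C ^+ 2 / delta]; the factor [4 * C]
compares the defect of such a point with [h]. *)
Definition skeleton_const (delta C : R) : R :=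
  4 * C * ((Num.truncn (32 * C ^+ 2 / delta)).+1 ^ 2)%:R.

(** The tree argument.  The point [l k] lies near the path from the origin to
[z i] when [z i] is in its [shadow]; it is [low] when it is a deepest such point,
that is one of smallest defect. *)
Lemma sum_defect_skeleton (T L : finType) (z : T -> R[i]) (l : L -> R[i])
    (delta C : R) :
  0 < delta -> 1 <= C ->
  (forall i, unit_disc (z i)) -> (forall k, unit_disc (l k)) ->
  (forall i j, i != j -> delta <= pseudohyp (z i) (z j)) ->
  (forall i j, i != j -> exists k, fuzzy_between C (z i) (l k) (z j)) ->
  \sum_i defect (z i) <= 1 + skeleton_const delta C * \sum_k defect (l k).
Proof.
move=> delta0 C1 zD lD zsep zl.
have C0 : 0 < C by lra.
have hz i : 0 < defect (z i) by apply: defect_gt0.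
have hl k : 0 < defect (l k) by apply: defect_gt0.
pose shadow k i := szego (l k) (z i) <= 2 * C * defect (l k).
pose low k i := shadow k i && [forall k', shadow k' i ==> (defect (l k) <= defect (l k'))].
(* A point between [z i] and [z j] is near one of the two paths, and not much
   deeper than the place where they separate. *)
have shadowP i j : i != j -> exists k, [/\ shadow k i || shadow k j &
    defect (l k) <= 4 * C * szego (z i) (z j)].
  move=> ij; have [k kP] := zl _ _ ij; exists k; move: kP; rewrite /fuzzy_between /shadow.
  have := szego_triangle (zD i) (lD k) (zD j).
  have := defect_le_szego (lD k) (zD i); have := defect_le_szego (lD k) (zD j).
  rewrite ![szego (z i) (l k)]szegoC.
  move: (hl k) (szego_gt0 (lD k) (zD i)) (szego_gt0 (lD k) (zD j)).
  move: (szego_gt0 (zD i) (zD j)).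
  move: (szego (l k) (z i)) (szego (l k) (z j)) (szego (z i) (z j)) (defect (l k)).
  move=> a b c h c0 h0 a0 b0 hb ha cab abc.
  split; last first.
    rewrite -(ler_pM2r h0); have : h * h <= (2 * a) * (2 * b) by rewrite ler_pM // ltW.
    lra.
  case: (leP a (2 * C * h)) => //= ah; rewrite leNgt; apply/negP => bh.
  have h1 : 2 * C * h * b < a * b by rewrite ltr_pM2r.
  have h2 : 2 * C * h * a < b * a by rewrite ltr_pM2r.
  have h3 : C * h * c <= C * h * (a + b) by rewrite ler_pM2l // mulr_gt0.
  lra.
have lowP i : (exists k, shadow k i) -> exists k, low k i.
  move=> [k0 nk0]; case: (@arg_minP _ _ _ k0 (fun k => shadow k i) (fun k => defect (l k)) nk0) => k nk kmin.
  exists k; rewrite /low nk; apply/forallP => k'; apply/implyP; exact: kmin.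
(* Two points in no shadow would have a point between them, with one of the
   two in its shadow. *)
rewrite (bigID (fun i => [exists k, shadow k i])) /= addrC; apply: lerD.
  have : (#|[pred i | ~~ [exists k, shadow k i]]| <= 1)%N.
    apply/card_le1_eqP => i j; rewrite !inE => ni nj.
    apply/eqP/negPn/negP => ij.
    have [k [/orP[nk|nk] _]] := shadowP _ _ ij.
      by case/negP: nj; apply/existsP; exists k.
    by case/negP: ni; apply/existsP; exists k.
  move=> card1; apply: (@le_trans _ _ (\sum_(i | ~~ [exists k, shadow k i]) 1)).
    by apply: ler_sum => i _; exact: defect_le1.
  by rewrite sumr_const (ler_nat R _ 1).
apply: (@le_trans _ _ (\sum_(i | [exists k, shadow k i]) \sum_(k | low k i) defect (z i))).
  apply: ler_sum => i /existsP /lowP [k lk].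
  rewrite (bigD1 k) //= lerDl; apply: sumr_ge0 => k' _; exact/ltW/hz.
(* It remains to bound the weight of the [z i] for which [l k] is lowest. *)
rewrite (exchange_big_dep xpredT) //= mulr_sumr; apply: ler_sum => k _.
set A := [set i | low k i]%SET.
apply: (@le_trans _ _ (\sum_(i in A) 4 * C * defect (l k))).
  rewrite (eq_bigl (fun i => i \in A)) => [|i]; last first.
    rewrite inE; apply: andb_idl => lk; apply/existsP; exists k.
    by case/andP: lk.
  apply: ler_sum => i; rewrite inE => /andP[nk _].
  apply: le_trans (defect_le_szego (zD i) (lD k)) _.
  by move: nk; rewrite /shadow szegoC; lra.
rewrite sumr_const -[_ *+ _]mulr_natr mulrAC /skeleton_const.
rewrite ler_pM2r // ler_pM2l ?mulr_gt0 // ler_nat.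
apply: (@card_separated_le _ _ z (l k) (2 * C * defect (l k)) (delta * (defect (l k) / (4 * C)))).
- by rewrite mulr_gt0 // divr_gt0 // mulr_gt0.
- move=> i; rewrite inE => /andP[nk _]; rewrite normcB.
  exact: le_trans (ler_dist_szego (lD k) (zD i)) nk.
- move=> i j; rewrite !inE => /andP[_ /forallP mi] /andP[_ /forallP mj] ij.
  have := zsep _ _ ij; rewrite /pseudohyp -/(szego _ _).
  rewrite ler_pdivlMr ?szego_gt0 //; apply: le_trans.
  rewrite ler_pM2l // ler_pdivrMr ?mulr_gt0 // mulrC.
  have [k' [nk kP]] := shadowP _ _ ij; apply: le_trans kP.
  by case/orP: nk => nk; [move/implyP: (mi k')|move/implyP: (mj k')]; apply.
- rewrite le_eqVlt; apply/orP; left; apply/eqP; field.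
  by rewrite !gt_eqF.
Qed.

End Skeleton.

(** * Comparison of kernel sums at an arbitrary base point *)

Section MoebiusInvariance.
Variable R : realType.

Lemma fuzzy_between_moebius C (a z xi w : R[i]) :
  unit_disc a -> unit_disc z -> unit_disc xi -> unit_disc w ->
  fuzzy_between C z xi w ->
  fuzzy_between C (moebius a z) (moebius a xi) (moebius a w).
Proof.
move=> aD zD xiD wD; rewrite /fuzzy_between !szego_moebius // moebius_kernel // /kernel.
have haD := defect_gt0 aD.
have z0 := szego_gt0 aD zD; have x0 := szego_gt0 aD xiD; have w0 := szego_gt0 aD wD.
move: (szego a z) (szego a xi) (szego a w) (defect a) haD z0 x0 w0 => p q r s s0 p0 q0 r0 h.
have c0 : 0 < s ^+ 2 / (p * r * q ^+ 2).
  by rewrite divr_gt0 ?mulr_gt0 ?exprn_gt0.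
rewrite -(ler_pM2r c0) in h.
rewrite [leLHS](_ : _ = szego z xi * szego xi w * (s ^+ 2 / (p * r * q ^+ 2))).
  apply: (le_trans h); rewrite le_eqVlt; apply/orP; left; apply/eqP.
  by field; rewrite !gt_eqF.
by field; rewrite !gt_eqF.
Qed.

Lemma sum_kernel_skeleton (T L : finType) (z : T -> R[i]) (l : L -> R[i])
    (delta C : R) (a : R[i]) :
  0 < delta -> 1 <= C -> unit_disc a ->
  (forall i, unit_disc (z i)) -> (forall k, unit_disc (l k)) ->
  (forall i j, i != j -> delta <= pseudohyp (z i) (z j)) ->
  (forall i j, i != j -> exists k, fuzzy_between C (z i) (l k) (z j)) ->
  \sum_i kernel a (z i) <= 1 + skeleton_const delta C * \sum_k kernel a (l k).
Proof.
move=> delta0 C1 aD zD lD zsep zl.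
rewrite (eq_bigr (fun i => defect (moebius a (z i)))) => [|i _]; last first.
  by rewrite moebius_kernel.
rewrite (eq_bigr (fun k => defect (moebius a (l k)))) => [|k _]; last first.
  by rewrite moebius_kernel.
apply: sum_defect_skeleton => // [i|k|i j ij|i j ij]; try exact: moebius_disc.
  by rewrite pseudohyp_moebius // zsep.
have [k kP] := zl _ _ ij; exists k; exact: fuzzy_between_moebius.
Qed.

(** A pseudo-hyperbolic distance of [1 / 2] gives [kernel xi l >= 3 / 4], and the
two applications of [szego_neighbour] then cost a factor [16 / 3]. *)
Lemma fuzzy_between_close (z xi w l : R[i]) :
  unit_disc z -> unit_disc xi -> unit_disc w -> unit_disc l ->
  szego z xi * szego xi w <= szego z w * defect xi ->
  pseudohyp xi l <= 2^-1 -> fuzzy_between 6 z l w.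
Proof.
move=> zD xiD wD lD btw close; rewrite /fuzzy_between.
have h0 := defect_gt0 xiD; have hl := defect_gt0 lD.
have P2 : szego xi l ^+ 2 <= 4 / 3 * (defect xi * defect l).
  have := sqr_pseudohyp xiD lD; rewrite /kernel.
  have : pseudohyp xi l ^+ 2 <= 4^-1.
    have -> : 4^-1 = (2^-1 : R) ^+ 2 by field.
    by rewrite lerXn2r ?nnegrE ?pseudohyp_ge0.
  have P0 : 0 < szego xi l ^+ 2 by rewrite exprn_gt0 // szego_gt0.
  move=> h1 h2; have : 3 / 4 <= defect xi * defect l / szego xi l ^+ 2 by lra.
  by rewrite ler_pdivlMr //; lra.
have n1 := szego_neighbour zD xiD lD.
have n2 := szego_neighbour wD xiD lD.
rewrite -(ler_pM2r (exprn_gt0 2 h0)).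
have h : szego z l * defect xi * (szego w l * defect xi) <=
    2 * szego z xi * szego xi l * (2 * szego w xi * szego xi l).
  by rewrite ler_pM ?mulr_ge0 ?szego_ge0 // ltW.
have b4 : 4 * (szego z xi * szego xi w) * szego xi l ^+ 2 <=
    4 * (szego z w * defect xi) * (4 / 3 * (defect xi * defect l)).
  by rewrite ler_pM ?mulr_ge0 ?exprn_ge0 ?szego_ge0 // ler_pM2l.
have c0 : 0 <= szego z w * (defect l * defect xi ^+ 2).
  by rewrite !mulr_ge0 ?exprn_ge0 ?szego_ge0 // ltW.
move: h b4; rewrite (szegoC w l) (szegoC w xi) => h b4.
lra.
Qed.

End MoebiusInvariance.

(** * Products of pseudo-hyperbolic distances and kernel sums *)

Section Products.
Variable R : realType.

(** By induction, from [(1 - x) * (1 + x + s) <= 1 + s]. *)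
Lemma prod_1B_le (I : Type) (r : seq I) (P : pred I) (x : I -> R) :
  (forall i, P i -> 0 <= x i <= 1) ->
  (\prod_(i <- r | P i) (1 - x i)) * (1 + \sum_(i <- r | P i) x i) <= 1.
Proof.
move=> x01; set p := \prod_(_ <- _ | _) _; set s := \sum_(_ <- _ | _) _.
suff : [/\ 0 <= p, 0 <= s & p * (1 + s) <= 1] by case.
rewrite {}/p {}/s.
elim/big_rec2: _ => [|i s p /x01 /andP[x0 x1] [p0 s0 ps]]; first by split; lra.
split; [by rewrite mulr_ge0 // subr_ge0|exact: addr_ge0|].
apply: le_trans ps.
have h1 : 0 <= p * (x i * s) by rewrite !mulr_ge0.
have h2 : 0 <= p * (x i * x i) by rewrite !mulr_ge0.
lra.
Qed.

(** From [1 / (1 - x) = 1 + x / (1 - x) <= exp (x / e)]. *)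
Lemma prod_1B_ge (I : Type) (r : seq I) (P : pred I) (x : I -> R) (e : R) :
  0 < e -> (forall i, P i -> 0 <= x i <= 1 - e) ->
  expR (- (\sum_(i <- r | P i) x i) / e) <= \prod_(i <- r | P i) (1 - x i).
Proof.
move=> e0 xe; rewrite mulNr mulr_suml -sumrN expR_sum.
apply: ler_prod => i /xe /andP[x0 x1]; rewrite expR_ge0 /=.
have y0 : 0 < 1 - x i by lra.
rewrite expRN -[leRHS]invrK lef_pV2 ?posrE ?expR_gt0 ?invr_gt0 //.
apply: le_trans (expR_ge1Dx _).
rewrite -(ler_pM2r y0) mulVf ?gt_eqF //.
have : x i <= x i / e * (1 - x i).
  by rewrite mulrAC -mulrA ler_peMr // ler_pdivlMr // mul1r; lra.
lra.
Qed.

Definition partial_prod (I : set nat) (z : nat -> R[i]) (k N : nat) : R :=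
  \prod_(n < N | ((n : nat) \in I) && ((n : nat) != k)) pseudohyp (z n) (z k).

Lemma partial_prod_ge0 (I : set nat) z k N : 0 <= partial_prod I z k N.
Proof. by apply: prodr_ge0 => i _; exact: pseudohyp_ge0. Qed.

Lemma partial_prod_nonincr (I : set nat) z k : (forall n, I n -> unit_disc (z n)) -> I k ->
  {homo partial_prod I z k : n m / (n <= m)%N >-> m <= n}.
Proof.
move=> zD Ik; apply/nonincreasing_seqP => N; rewrite /partial_prod.
rewrite big_mkcond /= big_ord_recr /= -big_mkcond /=.
case: ifP => [/andP[/set_mem IN _]|_]; last by rewrite mulr1.
by rewrite ler_piMr ?partial_prod_ge0 // ltW // pseudohyp_lt1 //; exact: zD.
Qed.

Lemma partial_prod_cvg (I : set nat) z k : (forall n, I n -> unit_disc (z n)) -> I k ->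
  cvg (partial_prod I z k @ \oo).
Proof.
move=> zD Ik; apply: nonincreasing_is_cvgn; first exact: partial_prod_nonincr.
by exists 0 => _ [N _ <-]; exact: partial_prod_ge0.
Qed.

Lemma sqr_partial_prod (I : set nat) z k N : (forall n, I n -> unit_disc (z n)) -> I k ->
  partial_prod I z k N ^+ 2 =
  \prod_(n < N | ((n : nat) \in I) && ((n : nat) != k)) (1 - kernel (z n) (z k)).
Proof.
move=> zD Ik; rewrite /partial_prod -prodrXl; apply: eq_bigr => n /andP[/set_mem In _].
by rewrite sqr_pseudohyp //; exact: zD.
Qed.

(** The squared factors are [1 - kernel], so [prod_1B_le] turns a lower bound
[eta] of the products into the bound [eta ^- 2] of the sums. *)
Lemma uniformly_separated_sum_kernel (I : set nat) (z : nat -> R[i]) :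
  (forall n, I n -> unit_disc (z n)) -> uniformly_separated_seq I z ->
  exists2 M : R, 0 <= M & forall k N, I k ->
    \sum_(n < N | (n : nat) \in I) kernel (z k) (z n) <= M.
Proof.
move=> zD; rewrite /uniformly_separated_seq; set E := [set _ | _ in I] => infE.
have [eta eta0 etaE] : exists2 eta : R, 0 < eta & forall x, E x -> (eta%:E <= x)%E.
  have lbE x : E x -> (ereal_inf E <= x)%E by exact: ereal_inf_lbound.
  case: (ereal_inf E) infE lbE => [r|_|//]; first by rewrite lte_fin; exists r.
  move=> lbE; exists 1 => // x /lbE; rewrite leye_eq => /eqP ->; exact: leey.
exists (eta ^- 2); first by rewrite invr_ge0 exprn_ge0 // ltW.
move=> k N Ik.
have eta_le : eta <= partial_prod I z k N.
  apply: le_trans (nonincreasing_cvgn_ge (partial_prod_nonincr zD Ik) (partial_prod_cvg zD Ik) N).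
  by rewrite -lee_fin; apply: etaE; exists k.
have K01 (n : 'I_N) : ((n : nat) \in I) && ((n : nat) != k) -> 0 <= kernel (z n) (z k) <= 1.
  move=> /andP[/set_mem In _]; have := sqr_ge0 (pseudohyp (z n) (z k)).
  rewrite sqr_pseudohyp; [|exact: zD..].
  by rewrite subr_ge0 => ->; rewrite andbT ltW // kernel_gt0 //; exact: zD.
have := prod_1B_le (index_enum 'I_N) K01.
rewrite -sqr_partial_prod //; set S := \sum_(_ <- _ | _) _ => PS.
have S0 : 0 <= S by apply: sumr_ge0 => n /K01 /andP[].
apply: (@le_trans _ _ (1 + S)).
  rewrite (bigID (fun n : 'I_N => (n : nat) == k)) /= lerD //; last first.
    by apply: ler_sum => n _; rewrite kernelC.
  rewrite (eq_bigr (fun=> 1)) => [|n /andP[_ /eqP ->]]; last first.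
    by rewrite kernelxx //; exact: zD.
  rewrite sumr_const (ler_nat R _ 1); apply/card_le1_eqP => n m.
  by move=> /andP[_ /eqP nk] /andP[_ /eqP mk]; apply: val_inj; rewrite /= nk mk.
rewrite -[leRHS]mul1r ler_pdivlMr ?exprn_gt0 // mulrC; apply: le_trans PS.
by rewrite ler_wpM2r ?addr_ge0 // lerXn2r ?nnegrE ?partial_prod_ge0 // ltW.
Qed.

(** Separation keeps the kernels away from [1], so [prod_1B_ge] applies to the
squared products; the factors being at most [1], squaring only decreases the
products. *)
Lemma sum_kernel_uniformly_separated (I : set nat) (z : nat -> R[i]) (M : R) :
  (forall n, I n -> unit_disc (z n)) -> separated_seq I z ->
  (forall k N, I k ->
    \sum_(n < N | (n : nat) \in I) kernel (z k) (z n) <= M) ->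
  uniformly_separated_seq I z.
Proof.
move=> zD [delta /andP[delta0 delta1] zsep] zM.
have d2 : 0 < delta ^+ 2 by rewrite exprn_gt0.
apply: (@lt_le_trans _ _ (expR (- M / delta ^+ 2))%:E).
  by rewrite lte_fin expR_gt0.
apply: le_ereal_inf_tmp => _ [k Ik <-]; rewrite lee_fin.
apply: limr_ge; first exact: partial_prod_cvg.
apply: nearW => N; rewrite -/(partial_prod I z k N).
apply: (@le_trans _ _ (partial_prod I z k N ^+ 2)); last first.
  rewrite expr2 ler_piMr ?partial_prod_ge0 //.
  have := partial_prod_nonincr zD Ik (leq0n N).
  by rewrite {2}/partial_prod big_ord0.
rewrite sqr_partial_prod //.
apply: le_trans (prod_1B_ge _ d2 _); last first.
  move=> n /andP[/set_mem In /eqP nk]; rewrite ltW ?kernel_gt0 //=; try exact: zD.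
  have := sqr_pseudohyp (zD _ In) (zD _ Ik).
  have : delta ^+ 2 <= pseudohyp (z n) (z k) ^+ 2.
    by rewrite lerXn2r ?nnegrE ?pseudohyp_ge0 // ltW // zsep.
  lra.
rewrite ler_expR !mulNr lerN2 ler_pM2r ?invr_gt0 //; apply: le_trans (zM k N Ik).
rewrite [leRHS](bigID (fun n : 'I_N => (n : nat) != k)) /=.
under eq_bigr do rewrite kernelC.
rewrite lerDl.
apply: sumr_ge0 => n /andP[/set_mem In _].
by rewrite ltW // kernel_gt0 //; exact: zD.
Qed.

End Products.

(** * Maximal separated subfamilies *)

(** Run through [I] in increasing order and keep an index when it is far from
all indices kept before. *)
Lemma greedy_net (I : set nat) (far : nat -> nat -> Prop) :
  (forall n k, far n k -> far k n) ->
  exists J : set nat, [/\ J `<=` I,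
    forall n k, J n -> J k -> n <> k -> far n k &
    forall i, I i -> J i \/ exists2 j, J j & ~ far i j].
Proof.
move=> farC.
pose picks := fix picks n : set nat := if n is m.+1 then
  picks m `|` [set k | k = m /\ I m /\ forall j, picks m j -> far m j] else set0.
pose J := [set n | I n /\ forall j, picks n j -> far n j].
have picksE n j : picks n j <-> (j < n)%N /\ J j.
  elim: n => [|n IH]; first by split=> // -[].
  split=> [[/IH[jn Jj]|[-> Jn]]|[]]; [by split; [exact: ltnW|]|by split|].
  rewrite ltnS leq_eqVlt => /orP[/eqP-> Jj|jn Jj]; [by right|by left; apply/IH].
exists J; split=> [n []//|n k Jn Jk nk|i Ii].
  have [nk'|kn|//] := ltngtP n k.
    by apply: farC; apply: (proj2 Jk); apply/picksE.
  by apply: (proj2 Jn); apply/picksE.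
have [Ji|nJi] := pselect (J i); [by left|right].
apply: contrapT => no; apply: nJi; split=> // j /picksE[_ Jj].
by apply: contrapT => nf; apply: no; exists j.
Qed.

(** * Uniform separation *)

Local Open Scope complex_scope.

Theorem theorem1 (R : realType) (z : nat -> R[i])
    (z_disc : forall n, unit_disc (z n))
    (z_sep : separated_seq setT z)
    (I : set nat) (Lambda : nat -> R[i])
    (Lambda_disc : forall i, I i -> unit_disc (Lambda i))
    (Lambda_segment : forall j k, z j <> z k ->
       exists2 i, I i & hyp_segment (z j) (z k) (Lambda i))
    (Lambda_subseq : forall J : set nat, J `<=` I ->
       separated_seq J Lambda -> uniformly_separated_seq J Lambda) :
  uniformly_separated_seq setT z.
Proof.
pose far n k : Prop := 2^-1 < pseudohyp (Lambda n) (Lambda k).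
have farC n k : far n k -> far k n by rewrite /far pseudohypC.
have [J [JI Jsep Jnet]] := greedy_net I farC.
have JD n : J n -> unit_disc (Lambda n) by move=> /JI; exact: Lambda_disc.
have [M M0 JM] : exists2 M : R, 0 <= M & forall k N, J k ->
    \sum_(n < N | (n : nat) \in J) kernel (Lambda k) (Lambda n) <= M.
  apply: uniformly_separated_sum_kernel => //; apply: Lambda_subseq => //.
  by exists 2^-1 => //; rewrite invr_gt0 ltr0n invf_lt1 // ltr1n.
have [delta /andP[delta0 _] zsep] := z_sep.
(* The net is coarse enough to be separated and fine enough to replace the
   points of [Lambda] on the segments. *)
have between i j : i != j -> exists2 l, J l & fuzzy_between 6 (z i) (Lambda l) (z j).
  move=> ij; have zij : z i <> z j.
    move=> zij; have := zsep _ _ Logic.I Logic.I (elimN eqP ij).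
    by rewrite zij /pseudohyp subrr normcz0 mul0r => /(lt_trans delta0); rewrite ltxx.
  have [m Im /szego_hyp_segment btw] := Lambda_segment _ _ zij.
  have mD := Lambda_disc _ Im.
  have [Jm|[l Jl /negP]] := Jnet _ Im.
    exists m => //; apply: (fuzzy_between_close _ mD) => //.
    by rewrite /pseudohyp subrr normcz0 mul0r invr_ge0.
  rewrite -leNgt => ml; exists l => //.
  by apply: (fuzzy_between_close _ mD) => //; exact: JD.
apply: (@sum_kernel_uniformly_separated _ _ _ (1 + skeleton_const delta 6 * (2 * M))) => // k N _.
rewrite (eq_bigl xpredT) => [|n]; last by rewrite /= in_setT.
have /choice[f fP] : forall p : 'I_N * 'I_N, exists l, p.1 != p.2 ->
    J l /\ fuzzy_between 6 (z p.1) (Lambda l) (z p.2).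
  move=> [i j] /=.
  have [->|ij] := eqVneq i j; first by exists 0%N.
  by have [l Jl lP] := between _ _ ij; exists l.
(* Finitely many pairs only use finitely many points of the net. *)
pose B := (\max_p f p).+1.
pose A := [set l : 'I_B | (l : nat) \in J]%SET.
pose lam (m : 'I_#|A|) := Lambda (enum_val m).
have lamD m : unit_disc (lam m).
  by apply: JD; have := enum_valP m; rewrite inE => /set_mem.
apply: (le_trans (sum_kernel_skeleton (l := lam) delta0 (ler1n _ 6) _ _ lamD _ _)) => //.
- by move=> i j /eqP ij; rewrite ltW // zsep // => /val_inj.
- move=> i j ij; have [Jl lP] := fP (i, j) ij.
  have lB : (f (i, j) < B)%N by rewrite ltnS; apply: leq_bigmax.
  have lA : Ordinal lB \in A by rewrite inE; apply: mem_set.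
  by exists (enum_rank_in lA (Ordinal lB)); rewrite /lam enum_rankK_in.
- rewrite lerD2l ler_wpM2l //.
  by rewrite /skeleton_const !mulr_ge0.
apply: sum_kernel_le => // m.
rewrite -(big_enum_val (fun l : 'I_B => kernel (lam m) (Lambda l))) /=.
rewrite (eq_bigl (fun l : 'I_B => (l : nat) \in J)) => [|l]; last by rewrite inE.
by apply: JM; have := enum_valP m; rewrite inE => /set_mem.
Qed.
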